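(* Let $E$ be a directed graph, let $F$ be an infinite field and let $A$ be an $F$-algebra. Suppose that $\phi:L_F(E)\to A$ is an $F$-algebra homomorphism such that $\phi(p_v)\neq0$ for every $v\in E^0$. If there exists a group action $\sigma:F^*\to\operatorname{Aut}_F(A)$ such that $\phi\circ\tau^E_t=\sigma_t\circ\phi$ for every $t\in F^*$, then $\phi$ is injective.
   Context: Algebras are associative, not necessarily unital. $E=(E^0,E^1)$ is an arbitrary directed graph with vertex set $E^0$, edge set $E^1$ and source and range maps $s,r:E^1\to E^0$. The Leavitt path algebra $L_F(E)$ is the universal $F$-algebra generated by a set $\{p_v:v\in E^0\}$ of pairwise orthogonal idempotents together with a set $\{x_e,y_e:e\in E^1\}$ of elements satisfying: (1) $p_{s(e)}x_e=x_e=x_ep_{r(e)}$ for $e\in E^1$; (2) $p_{r(e)}y_e=y_e=y_ep_{s(e)}$ for $e\in E^1$; (3) $y_ex_f=\delta_{e,f}p_{r(e)}$ for $e,f\in E^1$; (4) $p_v=\sum_{e\in s^{-1}(v)}x_ey_e$ for $v\in E^0$ with $0<|s^{-1}(v)|<\infty$. $F^*$ is the multiplicative group of $F$. For $t\in F^*$, $\tau^E_t$ is the $F$-algebra automorphism of $L_F(E)$ with $\tau^E_t(p_v)=p_v$ for $v\in E^0$ and $\tau^E_t(y_e)=t\,y_e$, $\tau^E_t(x_e)=t^{-1}x_e$ for $e\in E^1$ (the gauge action). *)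

(* Defs.v *)
From HB Require Import structures.
From mathcomp Require Import all_boot all_algebra generic_quotient finmap.
From mathcomp Require Import boolp classical_sets functions cardinality fsbigop.

Set Implicit Arguments.
Unset Strict Implicit.
Unset Printing Implicit Defensive.

Import GRing.Theory.
Local Open Scope classical_set_scope.
Local Open Scope quotient_scope.
Local Open Scope ring_scope.

Reserved Notation "x ** y" (at level 40, left associativity).

HB.mixin Record Lmodule_isNUAlgebra (F : fieldType) A of GRing.Lmodule F A := {
  numul : A -> A -> A;
  numulA : associative numul;
  numulDl : left_distributive numul +%R;
  numulDr : right_distributive numul +%R;
  numulZl : forall (k : F) (a b : A), numul (k *: a) b = k *: numul a b;
  numulZr : forall (k : F) (a b : A), numul a (k *: b) = k *: numul a b
}.

#[short(type="nuAlgType")]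
HB.structure Definition NUAlgebra (F : fieldType) :=
  {A of Lmodule_isNUAlgebra F A & GRing.Lmodule F A}.

Notation "x ** y" := (numul x y) : ring_scope.

HB.mixin Record isNUMultiplicative (F : fieldType) (A B : nuAlgType F)
    (f : A -> B) := {
  nuhomM : forall a b, f (a ** b) = f a ** f b
}.

#[short(type="nuAlgHom")]
HB.structure Definition NUAlgHom (F : fieldType) (A B : nuAlgType F) :=
  {f of isNUMultiplicative F A B f & @GRing.Linear F A B *:%R f}.

(* The inverse is carried as data, but is determined by [aut_hom]: see
   [nuAut_eq].  The product of the group is composition, (f * g) a = f (g a). *)
Record nuAut (F : fieldType) (A : nuAlgType F) := NUAut {
  aut_hom :> nuAlgHom A A;
  aut_inv : A -> A;
  aut_homK : cancel aut_hom aut_inv;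
  aut_invK : cancel aut_inv aut_hom
}.

Section AutGroup.
Variables (F : fieldType) (A : nuAlgType F).
Implicit Types f g h : nuAut A.

Lemma nuhom_eq (B : nuAlgType F) (f g : nuAlgHom A B) : f =1 g -> f = g.
Proof.
case: f g => [f cf] [g cg] /= fg.
have fgE : f = g by exact/funext.
case: _ / fgE cg {fg} => cg; congr NUAlgHom.Pack.
case: cf cg => [[M1] [S1] [Z1]] [[M2] [S2] [Z2]].
by rewrite (Prop_irrelevance M1 M2) (Prop_irrelevance S1 S2)
  (Prop_irrelevance Z1 Z2).
Qed.

Lemma nuAut_eq f g : f =1 g -> f = g.
Proof.
case: f g => [f f' fK f'K] [g g' gK g'K] /= fg.
have fgE : f = g by exact: nuhom_eq.
case: _ / fgE gK g'K {fg} => gK g'K.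
have f'g'E : f' = g' by apply/funext => a; rewrite -[in LHS](g'K a) fK.
case: _ / f'g'E gK g'K => gK g'K.
by congr NUAut; exact: Prop_irrelevance.
Qed.

Definition aut_one_fun (a : A) : A := a.

Lemma aut_one_linear : linear aut_one_fun.
Proof. by []. Qed.
HB.instance Definition _ :=
  GRing.isLinear.Build F A A *:%R aut_one_fun aut_one_linear.
HB.instance Definition _ := isNUMultiplicative.Build F A A aut_one_fun
  (fun _ _ => erefl).

Definition aut_one : nuAut A :=
  @NUAut F A aut_one_fun aut_one_fun (fun _ => erefl) (fun _ => erefl).

Definition aut_mul_fun f g (a : A) : A := f (g a).

Lemma aut_mul_linear f g : linear (aut_mul_fun f g).
Proof. by move=> k a b; rewrite /aut_mul_fun !linearP. Qed.
HB.instance Definition _ f g :=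
  GRing.isLinear.Build F A A *:%R (aut_mul_fun f g) (aut_mul_linear f g).
Lemma aut_mul_mult f g a b :
  aut_mul_fun f g (a ** b) = aut_mul_fun f g a ** aut_mul_fun f g b.
Proof. by rewrite /aut_mul_fun !nuhomM. Qed.
HB.instance Definition _ f g := isNUMultiplicative.Build F A A
  (aut_mul_fun f g) (aut_mul_mult f g).

Definition aut_mul f g : nuAut A :=
  @NUAut F A (aut_mul_fun f g) (aut_inv g \o aut_inv f)
    (can_comp (@aut_homK _ _ f) (@aut_homK _ _ g))
    (can_comp (@aut_invK _ _ g) (@aut_invK _ _ f)).

Definition aut_inv_fun f (a : A) : A := aut_inv f a.

Lemma aut_inv_linear f : linear (aut_inv_fun f).
Proof.
move=> k a b; rewrite /aut_inv_fun; apply: (can_inj (@aut_homK _ _ f)).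
by rewrite linearP /= !aut_invK.
Qed.
HB.instance Definition _ f :=
  GRing.isLinear.Build F A A *:%R (aut_inv_fun f) (aut_inv_linear f).
Lemma aut_inv_mult f a b :
  aut_inv_fun f (a ** b) = aut_inv_fun f a ** aut_inv_fun f b.
Proof.
rewrite /aut_inv_fun; apply: (can_inj (@aut_homK _ _ f)).
by rewrite nuhomM !aut_invK.
Qed.
HB.instance Definition _ f := isNUMultiplicative.Build F A A
  (aut_inv_fun f) (aut_inv_mult f).

Definition aut_inverse f : nuAut A :=
  @NUAut F A (aut_inv_fun f) f (@aut_invK _ _ f) (@aut_homK _ _ f).

Lemma aut_mulA : associative aut_mul.
Proof. by move=> f g h; exact: nuAut_eq. Qed.
Lemma aut_mul1 : left_id aut_one aut_mul.
Proof. by move=> f; exact: nuAut_eq. Qed.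
Lemma aut_mul1r : right_id aut_one aut_mul.
Proof. by move=> f; exact: nuAut_eq. Qed.
Lemma aut_mulV : left_inverse aut_one aut_inverse aut_mul.
Proof. by move=> f; apply: nuAut_eq => a; exact: (@aut_homK _ _ f). Qed.
Lemma aut_mulVr : right_inverse aut_one aut_inverse aut_mul.
Proof. by move=> f; apply: nuAut_eq => a; exact: (@aut_invK _ _ f). Qed.

HB.instance Definition _ := gen_eqMixin (nuAut A).
HB.instance Definition _ := gen_choiceMixin (nuAut A).
HB.instance Definition _ :=
  isGroup.Build (nuAut A) aut_mulA aut_mul1 aut_mul1r aut_mulV aut_mulVr.

End AutGroup.

Definition Fstar (F : fieldType) := {t : F | t != 0}.

Section FstarGroup.
Variable F : fieldType.
Implicit Types s t : Fstar F.

HB.instance Definition _ := SubChoice.on (Fstar F).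

Definition Fstar_one : Fstar F := exist _ 1 (oner_neq0 F).
Definition Fstar_mul s t : Fstar F :=
  exist _ (val s * val t) (mulf_neq0 (valP s) (valP t)).
Lemma Fstar_inv_subproof t : (val t)^-1 != 0.
Proof. by rewrite invr_eq0; exact: (valP t). Qed.
Definition Fstar_inv t : Fstar F := exist _ (val t)^-1 (Fstar_inv_subproof t).

Lemma Fstar_mulA : associative Fstar_mul.
Proof. by move=> r s t; apply: val_inj; exact: mulrA. Qed.
Lemma Fstar_mul1 : left_id Fstar_one Fstar_mul.
Proof. by move=> t; apply: val_inj; exact: mul1r. Qed.
Lemma Fstar_mul1r : right_id Fstar_one Fstar_mul.
Proof. by move=> t; apply: val_inj; exact: mulr1. Qed.
Lemma Fstar_mulV : left_inverse Fstar_one Fstar_inv Fstar_mul.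
Proof. by move=> t; apply: val_inj; apply: mulVf; exact: (valP t). Qed.
Lemma Fstar_mulVr : right_inverse Fstar_one Fstar_inv Fstar_mul.
Proof. by move=> t; apply: val_inj; apply: mulfV; exact: (valP t). Qed.

HB.instance Definition _ := isGroup.Build (Fstar F)
  Fstar_mulA Fstar_mul1 Fstar_mul1r Fstar_mulV Fstar_mulVr.

End FstarGroup.

Record digraph := Digraph {
  vertex : Type;
  edge : Type;
  src : edge -> vertex;
  rng : edge -> vertex
}.

(* [\sum_(e \in _)] needs a choiceType of indices; the structure is classical,
   so that vertices and edges may form arbitrary types. *)
HB.instance Definition _ (E : digraph) := gen_eqMixin (edge E).
HB.instance Definition _ (E : digraph) := gen_choiceMixin (edge E).

Record leavitt_family (E : digraph) (F : fieldType) (A : nuAlgType F)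
    (p : vertex E -> A) (x y : edge E -> A) : Prop := LeavittFamily {
  lf_idem : forall v, p v ** p v = p v;
  lf_orth : forall v w, v <> w -> p v ** p w = 0;
  lf_px : forall e, p (src e) ** x e = x e;
  lf_xp : forall e, x e ** p (rng e) = x e;
  lf_py : forall e, p (rng e) ** y e = y e;
  lf_yp : forall e, y e ** p (src e) = y e;
  lf_yx : forall e, y e ** x e = p (rng e);
  lf_yx0 : forall e f, e <> f -> y e ** x f = 0;
  lf_sum : forall v, [set e | src e = v] !=set0 ->
    finite_set ([set e | src e = v]) ->
    p v = \sum_(e \in [set e | src e = v]) (x e ** y e)
}.

(* Formal non-unital F-algebra expressions in the generators; the Leavitt path
   algebra is their quotient by the identities valid for all Leavitt E-families,
   and [lpa_lift], [lpa_liftP] and [lpa_hom_ext] say that it is universal. *)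
Inductive lpa_term (E : digraph) (F : fieldType) : Type :=
| TP of vertex E
| TX of edge E
| TY of edge E
| TZero
| TOpp of lpa_term E F
| TAdd of lpa_term E F & lpa_term E F
| TScale of F & lpa_term E F
| TMul of lpa_term E F & lpa_term E F.

Arguments TP {E F}.
Arguments TX {E F}.
Arguments TY {E F}.
Arguments TZero {E F}.

Fixpoint term_eval (E : digraph) (F : fieldType) (A : nuAlgType F)
    (p : vertex E -> A) (x y : edge E -> A) (a : lpa_term E F) : A :=
  match a with
  | TP v => p v
  | TX e => x e
  | TY e => y e
  | TZero => 0
  | TOpp b => - term_eval p x y b
  | TAdd b c => term_eval p x y b + term_eval p x y c
  | TScale k b => k *: term_eval p x y b
  | TMul b c => term_eval p x y b ** term_eval p x y c
  end.

Definition lpa_eq (E : digraph) (F : fieldType) (a b : lpa_term E F) : Prop :=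
  forall (A : nuAlgType F) (p : vertex E -> A) (x y : edge E -> A),
    leavitt_family p x y -> term_eval p x y a = term_eval p x y b.

HB.instance Definition _ (E : digraph) (F : fieldType) :=
  gen_eqMixin (lpa_term E F).
HB.instance Definition _ (E : digraph) (F : fieldType) :=
  gen_choiceMixin (lpa_term E F).

Section LeavittPathAlgebra.
Variables (E : digraph) (F : fieldType).
Local Notation term := (lpa_term E F).

Definition lpa_eqb (a b : term) : bool := `[< lpa_eq a b >].

Lemma lpa_eqb_equiv : equiv_class_of lpa_eqb.
Proof.
split=> [a|a b|b a c].
- exact/asboolP.
- by apply/asboolP/asboolP => ab A p x y pxy; rewrite ab.
- move=> /asboolP ab /asboolP bc; apply/asboolP => A p x y pxy.
  by rewrite ab // bc.
Qed.

Canonical lpa_eqb_equiv_rel := EquivRelPack lpa_eqb_equiv.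

Definition leavitt := {eq_quot lpa_eqb}.

HB.instance Definition _ := Choice.on leavitt.
HB.instance Definition _ := EqQuotient.on leavitt.

Lemma lpa_piP (a b : term) : \pi_leavitt a = \pi_leavitt b <-> lpa_eq a b.
Proof.
have e : (\pi_leavitt a == \pi_leavitt b) = lpa_eqb a b by exact: eqmodE.
by split=> [/eqP|ab]; [rewrite e => /asboolP | apply/eqP; rewrite e; exact/asboolP].
Qed.

Lemma lpa_repr (a : term) : lpa_eq (repr (\pi_leavitt a)) a.
Proof. by apply/lpa_piP; rewrite reprK. Qed.

Let pi := (fun a : term => \pi_leavitt a).

Definition lpa_zero : leavitt := pi TZero.
Definition lpa_opp (a : leavitt) : leavitt := pi (TOpp (repr a)).
Definition lpa_add (a b : leavitt) : leavitt := pi (TAdd (repr a) (repr b)).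
Definition lpa_scale (k : F) (a : leavitt) : leavitt := pi (TScale k (repr a)).
Definition lpa_mul (a b : leavitt) : leavitt := pi (TMul (repr a) (repr b)).

Lemma lpa_oppE a : lpa_opp (pi a) = pi (TOpp a).
Proof. by apply/lpa_piP => A p x y pxy /=; rewrite (lpa_repr _ pxy). Qed.
Lemma lpa_addE a b : lpa_add (pi a) (pi b) = pi (TAdd a b).
Proof. by apply/lpa_piP => A p x y pxy /=; rewrite !(lpa_repr _ pxy). Qed.
Lemma lpa_scaleE k a : lpa_scale k (pi a) = pi (TScale k a).
Proof. by apply/lpa_piP => A p x y pxy /=; rewrite (lpa_repr _ pxy). Qed.
Lemma lpa_mulE a b : lpa_mul (pi a) (pi b) = pi (TMul a b).
Proof. by apply/lpa_piP => A p x y pxy /=; rewrite !(lpa_repr _ pxy). Qed.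

Let piE := (lpa_oppE, lpa_addE, lpa_scaleE, lpa_mulE).

Lemma lpa_ind (P : leavitt -> Prop) : (forall a, P (pi a)) -> forall a, P a.
Proof. by move=> Ppi a; rewrite -[a]reprK; exact: Ppi. Qed.

Lemma lpa_addA : associative lpa_add.
Proof.
elim/lpa_ind=> a; elim/lpa_ind=> b; elim/lpa_ind=> c; rewrite !piE.
by apply/lpa_piP => A p x y _ /=; rewrite addrA.
Qed.
Lemma lpa_addC : commutative lpa_add.
Proof.
elim/lpa_ind=> a; elim/lpa_ind=> b; rewrite !piE.
by apply/lpa_piP => A p x y _ /=; rewrite addrC.
Qed.
Lemma lpa_add0 : left_id lpa_zero lpa_add.
Proof.
elim/lpa_ind=> a; rewrite !piE.
by apply/lpa_piP => A p x y _ /=; rewrite add0r.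
Qed.
Lemma lpa_addN : left_inverse lpa_zero lpa_opp lpa_add.
Proof.
elim/lpa_ind=> a; rewrite !piE.
by apply/lpa_piP => A p x y _ /=; rewrite addNr.
Qed.
HB.instance Definition _ :=
  GRing.isZmodule.Build leavitt lpa_addA lpa_addC lpa_add0 lpa_addN.

Lemma lpa_scaleA k l a : lpa_scale k (lpa_scale l a) = lpa_scale (k * l) a.
Proof.
elim/lpa_ind: a => a; rewrite !piE.
by apply/lpa_piP => A p x y _ /=; rewrite scalerA.
Qed.
Lemma lpa_scale1 : left_id 1 lpa_scale.
Proof.
elim/lpa_ind=> a; rewrite !piE.
by apply/lpa_piP => A p x y _ /=; rewrite scale1r.
Qed.
Lemma lpa_scaleDr : right_distributive lpa_scale +%R.
Proof.
move=> k; elim/lpa_ind=> a; elim/lpa_ind=> b; rewrite /+%R /= !piE.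
by apply/lpa_piP => A p x y _ /=; rewrite scalerDr.
Qed.
Lemma lpa_scaleDl (a : leavitt) :
  {morph lpa_scale^~ a : k l / k + l >-> k + l}.
Proof.
elim/lpa_ind: a => a k l; rewrite [in RHS]/+%R /= !piE.
by apply/lpa_piP => A p x y _ /=; rewrite scalerDl.
Qed.
HB.instance Definition _ := GRing.Zmodule_isLmodule.Build F leavitt
  lpa_scaleA lpa_scale1 lpa_scaleDr lpa_scaleDl.

Lemma lpa_mulA : associative lpa_mul.
Proof.
elim/lpa_ind=> a; elim/lpa_ind=> b; elim/lpa_ind=> c; rewrite !piE.
by apply/lpa_piP => A p x y _ /=; rewrite numulA.
Qed.
Lemma lpa_mulDl : left_distributive lpa_mul +%R.
Proof.
elim/lpa_ind=> a; elim/lpa_ind=> b; elim/lpa_ind=> c; rewrite /+%R /= !piE.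
by apply/lpa_piP => A p x y _ /=; rewrite numulDl.
Qed.
Lemma lpa_mulDr : right_distributive lpa_mul +%R.
Proof.
elim/lpa_ind=> a; elim/lpa_ind=> b; elim/lpa_ind=> c; rewrite /+%R /= !piE.
by apply/lpa_piP => A p x y _ /=; rewrite numulDr.
Qed.
Lemma lpa_mulZl k (a b : leavitt) : lpa_mul (k *: a) b = k *: lpa_mul a b.
Proof.
elim/lpa_ind: a => a; elim/lpa_ind: b => b; rewrite /GRing.scale /= !piE.
by apply/lpa_piP => A p x y _ /=; rewrite numulZl.
Qed.
Lemma lpa_mulZr k (a b : leavitt) : lpa_mul a (k *: b) = k *: lpa_mul a b.
Proof.
elim/lpa_ind: a => a; elim/lpa_ind: b => b; rewrite /GRing.scale /= !piE.
by apply/lpa_piP => A p x y _ /=; rewrite numulZr.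
Qed.
HB.instance Definition _ := Lmodule_isNUAlgebra.Build F leavitt
  lpa_mulA lpa_mulDl lpa_mulDr lpa_mulZl lpa_mulZr.

Definition lpa_p (v : vertex E) : leavitt := pi (TP v).
Definition lpa_x (e : edge E) : leavitt := pi (TX e).
Definition lpa_y (e : edge E) : leavitt := pi (TY e).

Lemma pi_TMul a b : pi (TMul a b) = pi a ** pi b.
Proof. by rewrite -lpa_mulE. Qed.
Lemma pi_TAdd a b : pi (TAdd a b) = pi a + pi b.
Proof. by rewrite -lpa_addE. Qed.
Lemma pi_TOpp a : pi (TOpp a) = - pi a.
Proof. by rewrite -lpa_oppE. Qed.
Lemma pi_TScale k a : pi (TScale k a) = k *: pi a.
Proof. by rewrite -lpa_scaleE. Qed.

Lemma pi_term_eval a : term_eval lpa_p lpa_x lpa_y a = pi a.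
Proof.
elim: a => //= [a ->|a -> b ->|k a ->|a -> b ->].
- by rewrite pi_TOpp.
- by rewrite pi_TAdd.
- by rewrite pi_TScale.
- by rewrite pi_TMul.
Qed.

Lemma lpa_leavitt_family : leavitt_family lpa_p lpa_x lpa_y.
Proof.
split=> [v|v w vw|e|e|e|e|e|e f ef|v v0 vfin];
  rewrite /lpa_p /lpa_x /lpa_y -?pi_TMul.
- by apply/lpa_piP => A p x y pxy /=; rewrite (lf_idem pxy).
- by apply/lpa_piP => A p x y pxy /=; rewrite (lf_orth pxy vw).
- by apply/lpa_piP => A p x y pxy /=; rewrite (lf_px pxy).
- by apply/lpa_piP => A p x y pxy /=; rewrite (lf_xp pxy).
- by apply/lpa_piP => A p x y pxy /=; rewrite (lf_py pxy).
- by apply/lpa_piP => A p x y pxy /=; rewrite (lf_yp pxy).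
- by apply/lpa_piP => A p x y pxy /=; rewrite (lf_yx pxy).
- by apply/lpa_piP => A p x y pxy /=; rewrite (lf_yx0 pxy ef).
- rewrite fsbig_finite //=.
  pose t := foldr (fun e => TAdd (TMul (TX e) (TY e))) TZero
    (fset_set ([set e | src e = v]) : seq (edge E)) : term.
  transitivity (pi t).
    apply/lpa_piP => A p x y pxy /=; rewrite (lf_sum pxy v0 vfin).
    rewrite fsbig_finite // /t.
    by elim: (enum_fset _) => [|e s IHs]; rewrite ?big_nil ?big_cons //= IHs.
  rewrite /t; elim: (enum_fset _) => [|e s IHs]; rewrite ?big_nil ?big_cons //=.
  by rewrite pi_TAdd IHs pi_TMul.
Qed.

Section Lift.
Variables (A : nuAlgType F) (p : vertex E -> A) (x y : edge E -> A).
Hypothesis pxy : leavitt_family p x y.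

Definition lpa_lift_of (_ : leavitt_family p x y) (a : leavitt) : A :=
  term_eval p x y (repr a).

Lemma lpa_lift_pi a : lpa_lift_of pxy (pi a) = term_eval p x y a.
Proof. exact: lpa_repr pxy. Qed.

Lemma lpa_lift_linear : linear (lpa_lift_of pxy).
Proof.
move=> k; elim/lpa_ind=> a; elim/lpa_ind=> b.
by rewrite -pi_TScale -pi_TAdd !lpa_lift_pi.
Qed.
HB.instance Definition _ :=
  GRing.isLinear.Build F leavitt A *:%R (lpa_lift_of pxy) lpa_lift_linear.

Lemma lpa_lift_mult a b :
  lpa_lift_of pxy (a ** b) = lpa_lift_of pxy a ** lpa_lift_of pxy b.
Proof.
elim/lpa_ind: a => a; elim/lpa_ind: b => b.
by rewrite -pi_TMul !lpa_lift_pi.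
Qed.
HB.instance Definition _ := isNUMultiplicative.Build F leavitt A
  (lpa_lift_of pxy) lpa_lift_mult.

Definition lpa_lift : nuAlgHom leavitt A := lpa_lift_of pxy.

Lemma lpa_liftP : [/\ forall v, lpa_lift (lpa_p v) = p v,
  forall e, lpa_lift (lpa_x e) = x e & forall e, lpa_lift (lpa_y e) = y e].
Proof. by split=> *; exact: lpa_lift_pi. Qed.

End Lift.

Lemma lpa_hom_ext (A : nuAlgType F) (f g : nuAlgHom leavitt A) :
  (forall v, f (lpa_p v) = g (lpa_p v)) ->
  (forall e, f (lpa_x e) = g (lpa_x e)) ->
  (forall e, f (lpa_y e) = g (lpa_y e)) -> f =1 g.
Proof.
move=> fgp fgx fgy; elim/lpa_ind; elim=> //= [|a IH|a IHa b IHb|k a IH|a IHa b IHb].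
- by rewrite -[pi _]/(0 : leavitt) !linear0.
- by rewrite pi_TOpp !linearN /= IH.
- by rewrite pi_TAdd !linearD /= IHa IHb.
- by rewrite pi_TScale !linearZ /= IH.
- by rewrite pi_TMul !nuhomM IHa IHb.
Qed.

Lemma gauge_family (t : Fstar F) : leavitt_family lpa_p
  (fun e => (val t)^-1 *: lpa_x e) (fun e => val t *: lpa_y e).
Proof.
have [pp po px xp py yp yx yx0 psum] := lpa_leavitt_family.
have t0 : val t != 0 := valP t.
split=> // [e|e|e|e|e|e f ef|v v0 vfin].
- by rewrite numulZr px.
- by rewrite numulZl xp.
- by rewrite numulZr py.
- by rewrite numulZl yp.
- by rewrite numulZl numulZr scalerA mulfV // scale1r yx.
- by rewrite numulZl numulZr yx0 // !scaler0.
- rewrite [LHS]psum //; apply: eq_fsbigr => e _.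
  by rewrite numulZl numulZr scalerA mulVf // scale1r.
Qed.

Definition gauge_hom (t : Fstar F) : nuAlgHom leavitt leavitt :=
  lpa_lift (gauge_family t).

Lemma gauge_homK (s t : Fstar F) : val s * val t = 1 ->
  cancel (gauge_hom t) (gauge_hom s).
Proof.
move=> st1 a; have [sp sx sy] := lpa_liftP (gauge_family s).
have [tp tx ty] := lpa_liftP (gauge_family t).
have ts1 : (val t)^-1 * (val s)^-1 = 1 by rewrite -invfM mulrC st1 invr1.
elim/lpa_ind: a; elim=> [v|e|e||a IH|a IHa b IHb|k a IH|a IHa b IHb].
- by rewrite /gauge_hom tp sp.
- by rewrite /gauge_hom tx linearZ /= sx scalerA ts1 scale1r.
- by rewrite /gauge_hom ty linearZ /= sy scalerA (mulrC (val t)) st1 scale1r.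
- by rewrite -[pi _]/(0 : leavitt) !linear0.
- by rewrite pi_TOpp !linearN /= IH.
- by rewrite pi_TAdd !linearD /= IHa IHb.
- by rewrite pi_TScale !linearZ /= IH.
- by rewrite pi_TMul !nuhomM IHa IHb.
Qed.

Definition gauge (t : Fstar F) : nuAut leavitt :=
  @NUAut F leavitt (gauge_hom t) (gauge_hom (t^-1)%g)
    (@gauge_homK t^-1%g t (mulVf (valP t)))
    (@gauge_homK t t^-1%g (mulfV (valP t))).

Lemma gaugeP (t : Fstar F) :
  [/\ forall v, gauge t (lpa_p v) = lpa_p v,
    forall e, gauge t (lpa_y e) = val t *: lpa_y e &
    forall e, gauge t (lpa_x e) = (val t)^-1 *: lpa_x e].
Proof. by have [] := lpa_liftP (gauge_family t). Qed.

End LeavittPathAlgebra.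

Arguments lpa_p {E} F v.
Arguments lpa_x {E} F e.
Arguments lpa_y {E} F e.
Arguments gauge E {F} t.

(* Main.v *)
Require Import Defs.
From HB Require Import structures.
From mathcomp Require Import all_boot all_algebra.
From mathcomp Require Import boolp classical_sets functions cardinality.
From mathcomp Require Import finmap fsbigop zify.

Set Implicit Arguments.
Unset Strict Implicit.
Unset Printing Implicit Defensive.

Import GRing.Theory.
Local Open Scope classical_set_scope.
Local Open Scope ring_scope.

(** The kernel of [phi] is gauge-invariant, so, [F] being infinite, Vandermonde
    makes it a graded ideal.  If [a] is homogeneous of nonzero degree then [a]
    is a sum of terms [x_e (y_e a)] or [(a x_e) y_e], which reduces the claim to
    degree 0.  In degree 0, write [a = d + b] with [d] in the span of the
    vertices and [b] a sum of terms [x_e c y_f], and let [q] be the sum of the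
    [x_e y_e] over the finitely many edges involved.  By induction on the length
    of the paths all [y_e a x_f] vanish, so [q a q = 0] and [a = d - d q].  Then
    [a p_v = c (p_v - p_v q)], and unless this is 0 the ideal contains
    [p_v] or [p_(r f)] for some edge [f] leaving [v]. *)

(** * Linear spans in a non-unital algebra *)

Section NonUnitalAlgebra.
Variables (F : fieldType) (A : nuAlgType F).
Implicit Types (a b c : A) (S T : A -> Prop).

Lemma numul0l b : 0 ** b = 0 :> A.
Proof. by rewrite -[X in X ** b](scale0r 0) numulZl scale0r. Qed.

Lemma numul0r a : a ** 0 = 0 :> A.
Proof. by rewrite -[X in a ** X](scale0r 0) numulZr scale0r. Qed.

Lemma numulNr a b : a ** - b = - (a ** b).
Proof. by rewrite -scaleN1r numulZr scaleN1r. Qed.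

Lemma numulNl a b : - a ** b = - (a ** b).
Proof. by rewrite -scaleN1r numulZl scaleN1r. Qed.

Lemma numul_suml I (r : seq I) (P : pred I) (f : I -> A) b :
  (\sum_(i <- r | P i) f i) ** b = \sum_(i <- r | P i) f i ** b.
Proof.
exact: (big_morph (fun a => a ** b) (fun x y => numulDl x y b) (numul0l b)).
Qed.

Lemma numul_sumr I (r : seq I) (P : pred I) (f : I -> A) a :
  a ** (\sum_(i <- r | P i) f i) = \sum_(i <- r | P i) a ** f i.
Proof.
exact: (big_morph (fun b => a ** b) (fun x y => numulDr a x y) (numul0r a)).
Qed.

Lemma linear_numul b : linear (numul b).
Proof. by move=> k c d; rewrite numulDr numulZr. Qed.

Lemma linear_numulr b : linear (numul^~ b).
Proof. by move=> k c d /=; rewrite numulDl numulZl. Qed.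

(** Linear combinations grow by one term at a time, so facts about spans are inductions that see a
    single generator. *)
Inductive span S : A -> Prop :=
| span0 : span S 0
| span_cons k s a : S s -> span S a -> span S (k *: s + a).

Lemma span_mem S s : S s -> span S s.
Proof.
by move=> Ss; rewrite -[s]addr0 -[s in s + _]scale1r; exact: span_cons (span0 S).
Qed.

Lemma spanD S a b : span S a -> span S b -> span S (a + b).
Proof.
move=> Sa Sb; elim: Sa => [|k s c Ss _ IH]; first by rewrite add0r.
by rewrite -addrA; exact: span_cons.
Qed.

Lemma spanZ S k a : span S a -> span S (k *: a).
Proof.
elim=> [|l s b Ss _ IH]; first by rewrite scaler0; exact: span0.
by rewrite scalerDr scalerA; exact: span_cons.
Qed.

Lemma span_sub S T : (forall s, S s -> T s) -> forall a, span S a -> span T a.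
Proof.
move=> ST a; elim=> [|k s b /ST Ts _ IH]; [exact: span0|exact: span_cons].
Qed.

Lemma span_image S T (f : A -> A) : linear f ->
  (forall s, S s -> span T (f s)) -> forall a, span S a -> span T (f a).
Proof.
move=> fl fST a; elim=> [|k s b Ss _ IH].
  suff -> : f 0 = 0 by exact: span0.
  (* Linearity at [-1, 0, 0] reads [f 0 = - f 0 + f 0]. *)
  by have := fl (-1) 0 0; rewrite scaler0 addr0 scaleN1r addNr.
by rewrite fl; apply: spanD => //; apply: spanZ; exact: fST.
Qed.

(** The source of local units: an element involves finitely many generators, and listing one
    suitable index for each of them gives [l0]. Taking all larger [l] lets finitely many such lists
    be concatenated. *)
Lemma span_eventually_fixed S (I : eqType) (f : seq I -> A -> A) :
  (forall l, linear (f l)) ->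
  (forall s, S s -> exists i, forall l, i \in l -> f l s = s) ->
  forall a, span S a ->
  exists l0 : seq I, forall l : seq I, {subset l0 <= l} -> f l a = a.
Proof.
move=> fl fS a; elim=> [|k s b Ss _ [l0 IH]].
  exists [::] => l _.
  by have := fl l (-1) 0 0; rewrite scaler0 addr0 scaleN1r addNr.
have [i is_] := fS s Ss; exists (i :: l0) => l sub.
rewrite fl is_ ?IH // => [j jl0|]; apply: sub; rewrite inE ?eqxx ?jl0 ?orbT //.
Qed.

Lemma span_split S T U : (forall s, S s -> T s \/ U s) ->
  forall a, span S a -> exists b c, [/\ span T b, span U c & a = b + c].
Proof.
move=> STU a; elim=> [|k s e /STU Ss _ [b [c [Tb Uc ->]]]].
  by exists 0, 0; split; [exact: span0|exact: span0|rewrite addr0].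
case: Ss => ss.
  by exists (k *: s + b), c; split=> //; [exact: span_cons|rewrite addrA].
by exists b, (k *: s + c); split=> //; [exact: span_cons|rewrite addrCA].
Qed.

End NonUnitalAlgebra.

(** * Vandermonde argument over an infinite field *)

Lemma infinite_uniq_nonzero (F : fieldType) n : infinite_set [set: F] ->
  exists s : seq F, [/\ uniq s, size s = n & 0 \notin s].
Proof.
(* One element more than [n], since 0 may have to be discarded. *)
move=> Finf; have [X _ Xn] := infinite_set_fset n.+1 Finf.
have sn : (n <= size (rem (0%R : F) (enum_fset X)))%N.
  case X0 : (0 \in enum_fset X); last by rewrite rem_id ?X0 // ltnW.
  by rewrite size_rem // -ltnS (ltn_predK Xn).
exists (take n (rem 0 (enum_fset X))); split.
- by rewrite take_uniq // rem_uniq // fset_uniq.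
- by rewrite size_takel.
- by apply/negP => /mem_take; rewrite mem_rem_uniqF // fset_uniq.
Qed.

Lemma vandermonde_lmod (F : fieldType) (V : lmodType F) n (b : nat -> V) :
  infinite_set [set: F] ->
  (forall t : F, t != 0 -> \sum_(j < n) t ^+ j *: b j = 0) ->
  forall j, (j < n)%N -> b j = 0.
Proof.
move=> Finf b0 j jn.
have [s [us ss s0]] := infinite_uniq_nonzero n Finf.
pose r : 'rV[F]_n := \row_i s`_i.
have Vu : Vandermonde n r \in unitmx.
  rewrite unitmxE det_Vandermonde unitfE; apply/prodf_neq0 => i _.
  apply/prodf_neq0 => k ik; rewrite !mxE subr_eq0 nth_uniq ?ss //.
  by rewrite neq_ltn ik orbT.
pose W := invmx (Vandermonde n r).
have VW : Vandermonde n r *m W = 1%:M by exact: mulmxV.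
(* The equation at the node [s_i] is weighted by the entry [W i j] of the inverse matrix; after
   exchanging the sums, [b k] gets the coefficient [(k == j)]. *)
have : \sum_i W i (Ordinal jn) *: \sum_(k < n) s`_i ^+ k *: b k = 0.
  apply: big1 => i _; rewrite b0 ?scaler0 //.
  by apply: contraNneq s0 => <-; rewrite mem_nth ?ss.
under eq_bigr do rewrite scaler_sumr.
rewrite exchange_big /=.
under eq_bigr => k _.
  under eq_bigr do rewrite scalerA.
  rewrite -scaler_suml.
  have -> : \sum_i W i (Ordinal jn) * s`_i ^+ k = (1%:M : 'M_n) k (Ordinal jn).
    by rewrite -VW !mxE; apply: eq_bigr => i _; rewrite !mxE mulrC.
  rewrite mxE.
  over.
rewrite (bigD1 (Ordinal jn)) //= eqxx scale1r big1 ?addr0 // => k.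
by move/negbTE ->; rewrite scale0r.
Qed.

(** Classical equality on vertices allows Kronecker deltas [(v == w)%:R] and duplicate-free lists of
    vertices. *)
HB.instance Definition _ (E : digraph) := gen_eqMixin (vertex E).

(** * Monomials and their products with the generators *)

Section Monomials.
Variables (E : digraph) (F : fieldType).
Local Notation L := (leavitt E F).
Local Notation p := (@lpa_p E F).
Local Notation x := (@lpa_x E F).
Local Notation y := (@lpa_y E F).
Implicit Types (a b c d : L) (e f : edge E) (v w : vertex E).
Implicit Types (s : seq (edge E)).

Let fam : leavitt_family p x y := @lpa_leavitt_family E F.
Let pp := lf_idem fam.
Let pp0 := lf_orth fam.
Let px := lf_px fam.
Let xp := lf_xp fam.
Let py := lf_py fam.
Let yp := lf_yp fam.
Let yx := lf_yx fam.
Let yx0 := lf_yx0 fam.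

Lemma p_mul v w : p v ** p w = (v == w)%:R *: p v.
Proof.
case: eqVneq => [->|/eqP vw]; first by rewrite scale1r pp.
by rewrite scale0r pp0.
Qed.

Lemma p_x v e : p v ** x e = (v == src e)%:R *: x e.
Proof.
rewrite -[x e in LHS]px numulA p_mul.
by case: eqVneq => [->|_]; rewrite numulZl ?scale1r ?px // !scale0r.
Qed.

Lemma y_p v e : y e ** p v = (v == src e)%:R *: y e.
Proof.
rewrite -[y e in LHS]yp -numulA p_mul eq_sym.
by case: eqVneq => _; rewrite numulZr ?scale1r ?yp // !scale0r.
Qed.

Lemma y_x e f : y e ** x f = (e == f)%:R *: p (rng e).
Proof.
case: eqVneq => [->|/eqP ef]; first by rewrite scale1r yx.
by rewrite scale0r yx0.
Qed.

(* [mono al v be] is [x_al p_v y_be], nonzero only when [al] and [be] are paths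
   ending at [v]; both lists are read from the outside in. *)
Definition mono (al : seq (edge E)) v (be : seq (edge E)) : L :=
  foldr (fun e a => x e ** a) (foldr (fun e a => a ** y e) (p v) be) al.

Lemma mono_consr al v f be : mono al v (f :: be) = mono al v be ** y f.
Proof. by elim: al => //= e al ->; rewrite numulA. Qed.

(** The scalar is 0 or 1; it stays existential because the spans in which these products are used
    absorb it. *)
Lemma p_mono w al v be : exists k : F, p w ** mono al v be = k *: mono al v be.
Proof.
case: al => [|e al] /=.
  exists (w == v)%:R; elim: be => /= [|e be IH].
    by rewrite p_mul; case: eqVneq => [->|]; rewrite ?scale0r.
  by rewrite numulA IH numulZl.
by exists (w == src e)%:R; rewrite numulA p_x numulZl.
Qed.

Lemma mono_p w al v be : exists k : F, mono al v be ** p w = k *: mono al v be.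
Proof.
case: be => [|f be].
  exists (v == w)%:R; elim: al => /= [|e al IH]; first exact: p_mul.
  by rewrite -numulA IH numulZr.
by exists (w == src f)%:R; rewrite mono_consr -numulA y_p numulZr.
Qed.

Lemma y_mono e al v be f : exists k : F,
  y e ** mono (f :: al) v be = k *: mono al v be.
Proof.
have [k pk] := p_mono (rng e) al v be; exists ((e == f)%:R * k).
by rewrite /= numulA y_x numulZl pk scalerA.
Qed.

(** Unless the product vanishes, [y e] becomes the innermost factor, hence [rcons], and the middle
    vertex moves from [src e] to [rng e]. *)
Lemma y_mono_nil e v be : exists k : F,
  y e ** mono [::] v be = k *: mono [::] (rng e) (rcons be e).
Proof.
exists (v == src e)%:R; elim: be => /= [|f be IH].
  by rewrite y_p py.
by rewrite numulA IH numulZl.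
Qed.

Lemma mono_x e al v be f : exists k : F,
  mono al v (f :: be) ** x e = k *: mono al v be.
Proof.
have [k pk] := mono_p (rng f) al v be; exists ((f == e)%:R * k).
by rewrite mono_consr -numulA y_x numulZr pk scalerA.
Qed.

Lemma gauge_mono (t : Fstar F) al v be : gauge E t (mono al v be) =
  ((val t)^-1 ^+ size al * val t ^+ size be) *: mono al v be.
Proof.
have [] := gaugeP E t; move: (aut_hom (gauge E t)) => g gp gy gx.
elim: al => /= [|e al IH].
  rewrite mul1r; elim: be => /= [|f be IH]; first by rewrite scale1r gp.
  by rewrite nuhomM IH gy numulZl numulZr scalerA exprSr.
by rewrite nuhomM IH gx numulZl numulZr scalerA exprS mulrA.
Qed.

(** * Spanning by monomials, and the grading *)

Definition is_mono a := exists al v be, a = mono al v be.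

Lemma span_mono a : span is_mono a.
Proof.
have sub (u : L) : (forall b, is_mono b -> span is_mono (u ** b)) ->
  forall c, span is_mono c -> span is_mono (u ** c).
  by move=> us; apply: span_image us; exact: linear_numul.
(* The induction on terms also carries stability of the span under left multiplication by [b]. The
   product case is then associativity, and two arbitrary monomials never have to be multiplied. *)
suff H b : span is_mono b /\ forall c, span is_mono c -> span is_mono (b ** c).
  by have [] := H a.
elim/lpa_ind: b; elim=> [v|e|e||b [Sb IH]|b [Sb IHb] c [Sc IHc]|k b [Sb IH]|
    b [Sb IHb] c [Sc IHc]].
- split; first by apply: span_mem; exists [::], v, [::].
  apply: sub => _ [al [w [be ->]]]; have [k ->] := p_mono v al w be.
  by apply: spanZ; apply: span_mem; exists al, w, be.
- split; first by apply: span_mem; exists [:: e], (rng e), [::]; rewrite /= xp.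
  apply: sub => _ [al [w [be ->]]].
  by apply: span_mem; exists (e :: al), w, be.
- split; first by apply: span_mem; exists [::], (rng e), [:: e]; rewrite /= py.
  apply: sub => _ [[|f al] [w [be ->]]].
    have [k ->] := y_mono_nil e w be; apply: spanZ; apply: span_mem.
    by exists [::], (rng e), (rcons be e).
  have [k ->] := y_mono e al w be f.
  by apply: spanZ; apply: span_mem; exists al, w, be.
- change (span is_mono (0 : L) /\
    forall c, span is_mono c -> span is_mono ((0 : L) ** c)).
  split; first exact: span0.
  by move=> c _; rewrite numul0l; exact: span0.
- rewrite pi_TOpp -scaleN1r; split; first exact: spanZ.
  by move=> c Sc; rewrite numulZl; apply: spanZ; exact: IH.
- rewrite pi_TAdd; split; first exact: spanD.
  by move=> d Sd; rewrite numulDl; apply: spanD; [exact: IHb|exact: IHc].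
- rewrite pi_TScale; split; first exact: spanZ.
  by move=> c Sc; rewrite numulZl; apply: spanZ; exact: IH.
- rewrite pi_TMul; split; first exact: IHb.
  by move=> d Sd; rewrite -numulA; apply: IHb; exact: IHc.
Qed.

(* Homogeneity of degree [m - n], where [x_e] has degree 1 and [y_e] degree -1. *)
Definition hom_mono m n a := exists al v be,
  a = mono al v be /\ (size al + n = size be + m)%N.

Definition homog m n := span (hom_mono m n).

Lemma gauge_homog (t : Fstar F) m n a : homog m n a ->
  gauge E t a = (val t ^+ n * (val t)^-1 ^+ m) *: a.
Proof.
elim=> [|k _ b [al [v [be [-> sz]]]] _ IH]; first by rewrite linear0 scaler0.
rewrite linearP /= IH gauge_mono scalerDr !scalerA [_ * k]mulrC.
congr (_ *: _ + _); congr (_ * _).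
have t0 : val t != 0 := valP t.
(* Clearing denominators turns the claim into an equality of exponents, which is [sz]. *)
apply/eqP; rewrite !exprVn mulrC eqr_div ?expf_neq0 //.
by rewrite -!exprD -sz addnC.
Qed.


(** * Finite edge sums as local units *)

Definition edge_sum s := \sum_(e <- undup s) x e ** y e.
Local Notation q := edge_sum.

(** Only the term of [e] survives, and [undup] makes it occur once even if [s] repeats edges. *)
Lemma edge_sum_x s e : e \in s -> q s ** x e = x e.
Proof.
move=> es; rewrite /edge_sum numul_suml (bigD1_seq e) ?mem_undup ?undup_uniq //=.
rewrite -numulA yx xp big1 ?addr0 // => f /eqP fe.
by rewrite -numulA yx0 // numul0r.
Qed.

Lemma y_edge_sum s e : y e ** q s = (e \in s)%:R *: y e.
Proof.
rewrite /edge_sum numul_sumr; case: (boolP (e \in s)) => es; last first.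
  rewrite scale0r big_seq big1 // => f; rewrite mem_undup => fs.
  by rewrite numulA yx0 ?numul0l // => ef; rewrite ef fs in es.
rewrite (bigD1_seq e) ?mem_undup ?undup_uniq //= numulA yx py scale1r.
by rewrite big1 ?addr0 // => f /eqP fe; rewrite numulA yx0 ?numul0l //; exact/nesym.
Qed.

Lemma edge_sum_idem s : q s ** q s = q s.
Proof.
rewrite {2}/edge_sum numul_sumr; apply: eq_big_seq => e; rewrite mem_undup => es.
by rewrite numulA edge_sum_x.
Qed.

(** Both products keep exactly the terms whose edge leaves [v]. *)
Lemma p_edge_sumC v s : p v ** q s = q s ** p v.
Proof.
rewrite /edge_sum numul_sumr numul_suml; apply: eq_bigr => e _.
by rewrite numulA p_x numulZl -numulA y_p numulZr.
Qed.

Definition is_vertex a := exists v, a = p v.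

Lemma span_vertex_edge_sumC d s : span is_vertex d -> d ** q s = q s ** d.
Proof.
elim=> [|k _ b [v ->] _ IH]; first by rewrite numul0l numul0r.
by rewrite numulDl numulDr IH numulZl numulZr p_edge_sumC.
Qed.

Lemma span_vertex_p d v : span is_vertex d -> exists k : F, d ** p v = k *: p v.
Proof.
elim=> [|k _ b [w ->] _ [l IH]]; first by exists 0; rewrite numul0l scale0r.
exists (k * (w == v)%:R + l); rewrite numulDl IH numulZl p_mul scalerDl scalerA.
by case: eqVneq => [->|]; rewrite // !mulr0 !scale0r.
Qed.

(** * The kernel of a homomorphism that kills no vertex *)

Section Kernel.
Variables (A : nuAlgType F) (phi : nuAlgHom L A).
Hypothesis phi_p : forall v, phi (p v) <> 0.

Lemma phi_mull a b : phi b = 0 -> phi (a ** b) = 0.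
Proof. by move=> b0; rewrite nuhomM b0 numul0r. Qed.

Lemma phi_mulr a b : phi a = 0 -> phi (a ** b) = 0.
Proof. by move=> a0; rewrite nuhomM a0 numul0l. Qed.

Lemma scale_p_eq0 k v : phi (k *: p v) = 0 -> k = 0.
Proof.
by rewrite linearZ /= => /eqP; rewrite scaler_eq0 => /orP[/eqP//|/eqP/phi_p].
Qed.

(** If an edge [f] leaving [v] is missing from [s], then compressing the gap by [y f] and [x f]
    gives [p (rng f)], so [k = 0]. If [v] is a sink, the gap is [p v] itself, and again [k = 0].
    Otherwise [v] emits finitely many edges, all in [s], and the gap vanishes by the summation
    relation at [v]. *)
Lemma vertex_gap_eq0 k v s :
  phi (k *: (p v - p v ** q s)) = 0 -> k *: (p v - p v ** q s) = 0.
Proof.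
move=> k0.
have [[f [fv fs]]|all_s] := pselect (exists f, src f = v /\ f \notin s).
  suff -> : k = 0 by rewrite scale0r.
  apply: (@scale_p_eq0 _ (rng f)).
  suff -> : p (rng f) = y f ** (p v - p v ** q s) ** x f.
    by rewrite -numulZl -numulZr; apply: phi_mulr; exact: phi_mull.
  rewrite numulDr numulNr numulA -fv yp y_edge_sum (negbTE fs) scale0r subr0.
  by rewrite yx.
have {}all_s f : src f = v -> f \in s.
  by move=> fv; apply: contrapT => /negP fs; apply: all_s; exists f.
have [v_ne|v_sink] := pselect ([set e | src e = v] !=set0); last first.
  have pq0 : p v ** q s = 0.
    rewrite /edge_sum numul_sumr big1 // => e _; rewrite numulA p_x.
    by case: eqVneq => [ve|_]; [case: v_sink; exists e|rewrite scale0r numul0l].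
  by rewrite pq0 subr0 in k0 *; rewrite (scale_p_eq0 k0) scale0r.
have v_fin : finite_set [set e | src e = v].
  by apply: (sub_finite_set _ (finite_seq s)) => f /= /all_s.
suff -> : p v ** q s = p v by rewrite subrr scaler0.
rewrite (lf_sum fam v_ne v_fin) fsbig_finite // numul_suml.
apply: eq_big_seq => e; rewrite in_fset_set // => /set_mem/all_s es.
by rewrite -numulA y_edge_sum es scale1r.
Qed.

(** A finite sum of vertices is a right unit for [d] and commutes with [q s]. It splits the gap into
    pieces at single vertices, which lie in the kernel as right multiples of the gap. *)
Lemma span_vertex_gap_eq0 d s : span is_vertex d ->
  phi (d - d ** q s) = 0 -> d - d ** q s = 0.
Proof.
move=> Vd k0; pose u (V : seq (vertex E)) := \sum_(v <- undup V) p v.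
have [V uV] : exists V0 : seq (vertex E), forall V : seq (vertex E),
    {subset V0 <= V} -> d ** u V = d.
  apply: (span_eventually_fixed (f := fun V => numul^~ (u V)) _ _ Vd).
    by move=> V; exact: linear_numulr.
  move=> _ [v ->]; exists v => V vV.
  rewrite /u numul_sumr (bigD1_seq v) ?mem_undup ?undup_uniq //= pp big1 ?addr0 //.
  by move=> w /eqP wv; rewrite pp0 //; exact/nesym.
have {uV} dV : d ** u V = d by exact: uV.
have -> : d - d ** q s = (d - d ** q s) ** u V.
  rewrite numulDl numulNl dV -numulA; congr (_ - _).
  have -> : q s ** u V = u V ** q s.
    rewrite /u numul_sumr numul_suml; apply: eq_bigr => v _.
    by rewrite p_edge_sumC.
  by rewrite numulA dV.
rewrite /u numul_sumr big1 // => v _; have [k dp] := span_vertex_p v Vd.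
have gap : (d - d ** q s) ** p v = k *: (p v - p v ** q s).
  by rewrite numulDl numulNl -numulA -p_edge_sumC numulA dp numulZl scalerBr.
by rewrite gap; apply: vertex_gap_eq0; rewrite -gap; exact: phi_mulr.
Qed.

(** * The degree-zero component, filtered by path length *)

Definition balanced N a := exists al v be,
  [/\ a = mono al v be, size al = size be & (size be <= N)%N].

(** The middle factor is arbitrary: the outer edges alone decide which edge sums fix the element. *)
Definition is_xy a := exists e c f, a = x e ** c ** y f.

Lemma balanced_split N a : balanced N a -> is_vertex a \/ (is_xy a /\ (0 < N)%N).
Proof.
move=> [[|e al] [v [[|f be] [-> //= sz leN]]]]; first by left; exists v.
right; split; last exact: leq_trans leN.
by exists e, (mono al v be), f; rewrite -numulA -mono_consr.
Qed.

(** A vertex goes to a multiple of a vertex; any other monomial goes to a multiple of the one with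
    an edge less on each side. *)
Lemma y_balanced_x N a e f : balanced N.+1 a -> span (balanced N) (y e ** a ** x f).
Proof.
move=> [[|e' al] [v [[|f' be] [-> //= sz leN]]]].
  rewrite y_p numulZl y_x; do 2 apply: spanZ; apply: span_mem.
  by exists [::], (rng e), [::].
have [k] := y_mono e al v (f' :: be) e'; rewrite /= => ->.
have [l] := mono_x f al v be f'; rewrite numulZl => ->.
by do 2 apply: spanZ; apply: span_mem; exists al, v, be; case: sz.
Qed.

Lemma balanced_ker N a : span (balanced N) a -> phi a = 0 -> a = 0.
Proof.
elim: N a => [|N IH] a Ba a0.
  have [d [b [Vd Vb ab]]] := span_split (@balanced_split 0) Ba.
  have {Vb} b0 : b = 0.
    by elim: Vb => // k s c [_]; rewrite ltnn.
  (* For the empty list the edge sum is 0, so the gap is [d] itself. *)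
  have := @span_vertex_gap_eq0 d [::] Vd.
  rewrite /edge_sum big_nil numul0r subr0 ab b0 addr0; apply.
  by rewrite -[d]addr0 -b0 -ab.
have yax0 e f : y e ** a ** x f = 0.
  apply: IH; last by apply: phi_mulr; exact: phi_mull.
  have lin : linear (fun c => y e ** c ** x f).
    by move=> k c d; rewrite numulDr numulZr numulDl numulZl.
  by apply: span_image lin _ _ Ba => c; exact: y_balanced_x.
have split1 c : balanced N.+1 c -> is_vertex c \/ is_xy c.
  by move=> /balanced_split[|[]]; [left|right].
have [d [b [Vd Vb ab]]] := span_split split1 Ba.
have [s1 qb1] : exists s1 : seq (edge E), forall s, {subset s1 <= s} -> q s ** b = b.
  apply: (span_eventually_fixed (f := fun s => numul (q s)) _ _ Vb).
    by move=> s; exact: linear_numul.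
  move=> _ [e [c [f ->]]]; exists e => s es.
  by rewrite !numulA edge_sum_x.
have [s2 qb2] : exists s2 : seq (edge E), forall s, {subset s2 <= s} -> b ** q s = b.
  apply: (span_eventually_fixed (f := fun s => numul^~ (q s)) _ _ Vb).
    by move=> s; exact: linear_numulr.
  move=> _ [e [c [f ->]]]; exists f => s fs.
  by rewrite -!numulA y_edge_sum fs scale1r.
pose s := s1 ++ s2.
have {qb1} qb : q s ** b = b by apply: qb1 => e; rewrite mem_cat => ->.
have {qb2} bq : b ** q s = b by apply: qb2 => e; rewrite mem_cat orbC => ->.
have qaq : q s ** a ** q s = 0.
  rewrite /edge_sum 2!numul_suml big1 // => e _.
  rewrite numul_sumr big1 // => f _.
  by rewrite -!numulA [a ** _]numulA [y e ** _]numulA [y e ** _]numulA yax0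
     numul0l numul0r.
have aE : a = d - d ** q s.
  (* Since [q s] fixes [b] on both sides and commutes with [d], [qaq] becomes [d ** q s + b = 0]. *)
  rewrite [LHS]ab; congr (_ + _); apply/eqP; rewrite -addr_eq0 addrC; apply/eqP.
  move: qaq; rewrite ab numulDr numulDl qb bq -span_vertex_edge_sumC //.
  by rewrite -numulA edge_sum_idem.
by rewrite aE; apply: span_vertex_gap_eq0; rewrite -?aE.
Qed.

(** * Homogeneous elements of the kernel *)

Lemma homog_balanced m a : homog m m a -> exists N, span (balanced N) a.
Proof.
elim=> [|k _ b [al [v [be [-> sz]]]] _ [N IH]]; first by exists 0%N; exact: span0.
exists (maxn (size be) N); apply: span_cons.
  by exists al, v, be; split; [|exact: addIn sz|exact: leq_maxl].
apply: span_sub IH => _ [al' [v' [be' [-> sz' leN]]]].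
by exists al', v', be'; split=> //; rewrite leq_max leN orbT.
Qed.

(** Induction on the degree [k]: in positive degree every monomial begins with some [x f], so an
    edge sum fixes [a] from the left, and each [y e ** a] has degree one less. *)
Lemma homog_ker_ge n k a : homog (n + k) n a -> phi a = 0 -> a = 0.
Proof.
elim: k a => [|k IH] a Ha a0.
  rewrite addn0 in Ha; have [N Ba] := homog_balanced Ha.
  exact: balanced_ker Ba a0.
have ya0 e : y e ** a = 0.
  apply: IH; last exact: phi_mull.
  apply: span_image (linear_numul (y e)) _ _ Ha => _ [[|f al] [v [be [-> sz]]]].
    by move: sz => /=; lia.
  have [l ->] := y_mono e al v be f; apply: spanZ; apply: span_mem.
  by exists al, v, be; split=> //; move: sz => /=; lia.
have [s qs] :
    exists s0 : seq (edge E), forall s, {subset s0 <= s} -> q s ** a = a.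
  apply: (span_eventually_fixed (f := fun s => numul (q s)) _ _ Ha).
    by move=> s; exact: linear_numul.
  move=> _ [[|f al] [v [be [-> sz]]]]; first by move: sz => /=; lia.
  by exists f => s fs /=; rewrite numulA edge_sum_x.
rewrite -(qs s) // /edge_sum numul_suml big1 // => e _.
by rewrite -numulA ya0 numul0r.
Qed.

(** The mirror image: in negative degree every monomial ends with some [y f], and multiplying by
    [x e] on the right raises the degree by one. *)
Lemma homog_ker_le n k a : homog n (n + k) a -> phi a = 0 -> a = 0.
Proof.
elim: k a => [|k IH] a Ha a0.
  by rewrite addn0 in Ha; apply: (@homog_ker_ge n 0); rewrite ?addn0.
have ax0 e : a ** x e = 0.
  apply: IH; last exact: phi_mulr.
  apply: span_image (linear_numulr (x e)) _ _ Ha => _ [al [v [[|f be] [-> sz]]]].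
    by move: sz => /=; lia.
  have [l ->] := mono_x e al v be f; apply: spanZ; apply: span_mem.
  by exists al, v, be; split=> //; move: sz => /=; lia.
have [s qs] :
    exists s0 : seq (edge E), forall s, {subset s0 <= s} -> a ** q s = a.
  apply: (span_eventually_fixed (f := fun s => numul^~ (q s)) _ _ Ha).
    by move=> s; exact: linear_numulr.
  move=> _ [al [v [[|f be] [-> sz]]]]; first by move: sz => /=; lia.
  by exists f => s fs /=; rewrite mono_consr -numulA y_edge_sum fs scale1r.
rewrite -(qs s) // /edge_sum numul_sumr big1 // => e _.
by rewrite numulA ax0 numul0l.
Qed.

Lemma homog_ker m n a : homog m n a -> phi a = 0 -> a = 0.
Proof.
have [/subnKC<-|/ltnW/subnKC<-] := leqP m n; first exact: homog_ker_le.
exact: homog_ker_ge.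
Qed.

End Kernel.

(** * Homogeneous components and the conclusion *)

Lemma homog_decomposition a : exists N0, forall N, (N0 <= N)%N ->
  exists g : nat -> L,
    (forall j, homog j N (g j)) /\ a = \sum_(j < N.*2.+1) g j.
Proof.
elim: (span_mono a) => [|k _ b [al [v [be ->]]] _ [N1 IH]].
  exists 0%N => N _; exists (fun _ => 0); split=> [j|]; first exact: span0.
  by rewrite big1.
(* Allowing every large [N] lets the new term and the rest share the same one. *)
exists (maxn N1 (size al + size be)) => N.
(* Index [j] stands for degree [j - N], so the new monomial sits at index [i]; the subtraction is
   exact because [size be <= N]. *)
rewrite geq_max => /andP[/IH[g [hg ->]] leN].
pose i := (size al + N - size be)%N.
have i_lt : (i < N.*2.+1)%N by rewrite /i; lia.
exists (fun j => (if j == i then k *: mono al v be else 0) + g j); split=> [j|].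
  apply: spanD (hg j); case: eqVneq => [->|_]; last exact: span0.
  apply: spanZ; apply: span_mem; exists al, v, be; split=> //.
  by rewrite /i; lia.
rewrite big_split /=; congr (_ + _).
rewrite (bigD1 (Ordinal i_lt)) //= eqxx big1 ?addr0 // => j.
by rewrite -val_eqE => /negbTE /= ->.
Qed.

End Monomials.

Theorem corollary6p4 (E : digraph) (F : fieldType) (A : nuAlgType F)
    (phi : nuAlgHom (leavitt E F) A) :
  infinite_set [set: F] ->
  (forall v : vertex E, phi (lpa_p F v) <> 0) ->
  (exists sigma : {multiplicative Fstar F -> nuAut A},
     forall t : Fstar F, phi \o gauge E t = sigma t \o phi) ->
  injective phi.
Proof.
move=> Finf phi_p [sigma sigmaE] a b ab; apply/eqP; rewrite -subr_eq0; apply/eqP.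
have {ab} : phi (a - b) = 0 by rewrite linearB /= ab subrr.
move: {a b}(a - b) => a a0.
have [N /(_ N (leqnn N)) [g [hg aE]]] := homog_decomposition a.
suff g0 j : (j < N.*2.+1)%N -> g j = 0 by rewrite aE big1 // => j _; exact: g0.
move=> jN; apply: (homog_ker phi_p (hg j)).
apply: (vandermonde_lmod (b := fun j => phi (g j)) Finf _ jN) => t t0.
(* The gauge action at [t^-1] multiplies [g j] by [t ^+ j] up to the common factor [t^-1 ^+ N], so
   nonnegative powers of [t] remain once that nonzero factor is cancelled. *)
pose u : Fstar F := exist _ t^-1 (invr_neq0 t0).
have : phi (gauge E u a) = 0.
  by have /= -> := congr1 (@^~ a) (sigmaE u); rewrite a0 linear0.
rewrite aE !linear_sum /=.
under eq_bigr => i _ do rewrite (gauge_homog u (hg i)) /= linearZ /= invrK -scalerA.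
rewrite -scaler_sumr => /eqP; rewrite scaler_eq0 => /orP[|/eqP//].
by rewrite expf_eq0 invr_eq0 (negbTE t0) andbF.
Qed.
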